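(* Let $n\ge3$ and $r\ge1$ be integers. The cyclic product $K_{n,r}$ is totally nonnegative, i.e., every square subdeterminant (minor) of $K_{n,r}$ is nonnegative.
   Context: For integers $n\ge3$ and $r\ge1$, the digraph $\Gamma_{n,r}$ has vertex set $V(\Gamma_{n,r})=\{1,2,\dots,rn-2r+2\}$ and directed edge set $E(\Gamma_{n,r})$ defined by $E(\Gamma_{n,1})=\{(j,j+1):1\le j\le n-1\}\cup\{(n,1)\}$; $E(\Gamma_{n,2})=E(\Gamma_{n,1})\cup\{(1,n+1)\}\cup\{(j,j+1):n+1\le j\le 2n-3\}\cup\{(2n-2,n)\}$; and for $r\ge3$, $E(\Gamma_{n,r})=E(\Gamma_{n,2})\cup\bigcup_{i=1}^{r-2}F_i$, where $F_i=\{(in-2i+2,\,in+n-2i+1)\}\cup\{(j,j+1):in+n-2i+1\le j\le in+2n-2i-3\}\cup\{(in+2n-2i-2,\,in+n-2i)\}$. (For $n=3$ the middle path parts are empty.) Layers: define $\ell:V(\Gamma_{n,r})\to\mathbb Z/n\mathbb Z$ along this recursive construction (edges being added in the order in which they are listed above) by $\ell(1)=0$ and, whenever a vertex $v\ne1$ appears for the first time as the terminal vertex of a newly added edge $(u,v)$, $\ell(v)\equiv\ell(u)+1 \pmod n$. For $c\in\mathbb Z/n\mathbb Z$ set $V^{(c)}_{n,r}=\{v:\ell(v)\equiv c \pmod n\}$. Every edge goes from some $V^{(c)}_{n,r}$ to $V^{(c+1)}_{n,r}$ (indices mod $n$). Let $B_{n,r}^{(c)}$ be the $(0,1)$-matrix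 with rows indexed by $V^{(c)}_{n,r}$ and columns by $V^{(c+1)}_{n,r}$ (each in increasing order, indices mod $n$), with $(u,v)$-entry $1$ if and only if $(u,v)\in E(\Gamma_{n,r})$. The cyclic product core is the square matrix $K_{n,r}=B_{n,r}^{(0)}B_{n,r}^{(1)}\cdots B_{n,r}^{(n-1)}$, indexed by $V^{(0)}_{n,r}$ in increasing order. *)

(* Defs.v *)
From HB Require Import structures.
From mathcomp Require Import all_boot all_order all_algebra.

Set Implicit Arguments.
Unset Strict Implicit.
Unset Printing Implicit Defensive.

Import Order.TTheory GRing.Theory Num.Theory.

(* The vertices of Gamma_{n,r} are the natural numbers 1, ..., r n - 2 r + 2.
   For n >= 3 none of the subtractions below truncates. *)
Definition vertices (n r : nat) : seq nat := iota 1 (r * n - 2 * r + 2).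

(* The edges (j, j + 1) for a <= j <= b; empty when b < a. *)
Definition path_edges (a b : nat) : seq (nat * nat) :=
  [seq (j, j.+1) | j <- index_iota a b.+1].

Definition first_edges (n : nat) : seq (nat * nat) :=
  path_edges 1 (n - 1) ++ [:: (n, 1)].

Definition second_edges (n : nat) : seq (nat * nat) :=
  (1, n + 1) :: path_edges (n + 1) (2 * n - 3) ++ [:: (2 * n - 2, n)].

Definition F (n i : nat) : seq (nat * nat) :=
  (i * n - 2 * i + 2, i * n + n - 2 * i + 1)
  :: path_edges (i * n + n - 2 * i + 1) (i * n + 2 * n - 2 * i - 3)
  ++ [:: (i * n + 2 * n - 2 * i - 2, i * n + n - 2 * i)].

(* The edge set of Gamma_{n,r}, as a list recording the order in which the
   edges are added; this order is what the recursive definition of the layers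
   runs along. *)
Definition edges (n r : nat) : seq (nat * nat) :=
  first_edges n
  ++ (if 2 <= r then second_edges n else [::])
  ++ flatten [seq F n i | i <- iota 1 (r - 2)].

(* Layers are partial functions from vertices to Z/nZ, residue classes being
   represented by naturals < n; [None] means "not reached yet". *)
Definition add_edge (n : nat) (l : nat -> option nat) (e : nat * nat) :
    nat -> option nat :=
  if l e.2 is Some _ then l
  else [eta l with e.2 |-> omap (fun c => c.+1 %% n) (l e.1)].

Definition layer (n r : nat) : nat -> option nat :=
  foldl (add_edge n) [fun v => None with 1 |-> Some 0] (edges n r).

(* V^(c), in increasing order; the index c matters only modulo n. *)
Definition V (n r c : nat) : seq nat :=
  [seq v <- vertices n r | layer n r v == Some (c %% n)].

Lemma V_period (n r : nat) : V n r n = V n r 0.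
Proof. by rewrite /V modnn mod0n. Qed.

Definition B (n r c : nat) : 'M[int]_(size (V n r c), size (V n r c.+1)) :=
  \matrix_(i, j)
    (((nth 0 (V n r c) i, nth 0 (V n r c.+1) j) \in edges n r)%:R)%R.

(* B^(0) B^(1) ... B^(k-1) *)
Fixpoint B_prod (n r k : nat) : 'M[int]_(size (V n r 0), size (V n r k)) :=
  match k with
  | 0 => 1%:M
  | k'.+1 => B_prod n r k' *m B n r k'
  end%R.

(* The cast identifies the column index set V^(n) with V^(0). *)
Definition K (n r : nat) : 'M[int]_(size (V n r 0)) :=
  castmx (erefl, congr1 size (V_period n r)) (B_prod n r n).

Definition totally_nonnegative (R : numDomainType) (m : nat) (A : 'M[R]_m) :
    Prop :=
  forall (k : nat) (f g : 'I_k -> 'I_m),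
    {homo f : i j / (i < j)%N} -> {homo g : i j / (i < j)%N} ->
    (0 <= \det (mxsub f g A))%R.

(* Main.v *)
Require Import Defs.
From HB Require Import structures.
From mathcomp Require Import all_boot all_order all_algebra.
From mathcomp Require Import all_fingroup zify.

(** The argument has a linear-algebra half and a combinatorial half.

    By the Cauchy-Binet formula, a product of matrices with nonnegative minors
    has nonnegative minors ([minors_nonneg_mul]), so it is enough to treat each
    factor B^(c).  Read such a 0/1 matrix as a bipartite graph drawn between
    two ordered lines of vertices.  If no two of its edges cross, then in any
    square submatrix a permutation all of whose entries are nonzero has no
    inversion, hence is the identity, and the minor is the product of the
    diagonal entries ([noncrossing_minors_nonneg]).

    It remains to see that edges u -> v and u' -> v' with u < u' in a common
    layer satisfy v <= v' ([chain_edge_noncrossing]).  Write m = n - 2 and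
    a_q = q m + 2.  Each new cell adds the interval of vertices
    a_q + 1, ..., a_(q+1), and apart from the steps u -> u + 1 every edge joins
    two vertices that are ends of such intervals or the vertex 1.  The layers
    have a closed form: l(v) + 1 is congruent modulo n to the height of v, a
    strictly increasing function equal to v + floor((v - 3) / m) for v >= 3 and
    to v otherwise ([layer_height]).  Two vertices u < u' of a common layer
    thus differ in height by n or by at least 2 n, and this gap excludes every
    pair of edges that could cross. *)

Set Implicit Arguments.
Unset Strict Implicit.
Unset Printing Implicit Defensive.

Import Order.TTheory GRing.Theory Num.Theory.

(** * Nonnegative minors: products and noncrossing matrices *)

Section Minors.

Local Open Scope ring_scope.

(** Total nonnegativity for rectangular matrices: the partial products of the
    B^(c) need not be square. *)
Definition minors_nonneg (R : numDomainType) (m p : nat) (A : 'M[R]_(m, p)) :=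
  forall (k : nat) (f : 'I_k -> 'I_m) (g : 'I_k -> 'I_p),
    {homo f : i j / (i < j)%N} -> {homo g : i j / (i < j)%N} ->
    0 <= \det (mxsub f g A).

(** Multilinearity of the determinant in the rows, each row of [A *m B] being a
    combination of the rows of [B]. *)
Lemma sum_rowsub_det (R : comNzRingType) (k m : nat)
    (A : 'M[R]_(k, m)) (B : 'M[R]_(m, k)) :
  \det (A *m B) =
    \sum_(f : {ffun 'I_k -> 'I_m}) (\prod_i A i (f i)) * \det (rowsub f B).
Proof.
rewrite [LHS]/determinant.
under eq_bigr => s _.
  under eq_bigr => i _ do rewrite mxE.
  rewrite bigA_distr_bigA /= mulr_sumr.
  over.
rewrite exchange_big /=; apply: eq_bigr => f _.
rewrite /determinant mulr_sumr; apply: eq_bigr => s _.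
rewrite big_split /= mulrCA; congr (_ * (_ * _)).
by apply: eq_bigr => i _; rewrite mxE.
Qed.

Lemma det_rowsub_perm (R : comNzRingType) (k m : nat) (f : 'I_k -> 'I_m)
    (s : 'S_k) (B : 'M[R]_(m, k)) :
  \det (rowsub (f \o s) B) = (-1) ^+ s * \det (rowsub f B).
Proof.
rewrite -det_perm -det_mulmx -row_permE; congr (\det _).
by apply/matrixP => i j; rewrite !mxE.
Qed.

Lemma det_colsub_perm (R : comNzRingType) (k m : nat) (f : 'I_k -> 'I_m)
    (s : 'S_k) (A : 'M[R]_(k, m)) :
  \det (colsub (f \o s) A) = (-1) ^+ s * \det (colsub f A).
Proof.
rewrite -!(det_tr (colsub _ _)) !trmx_mxsub; exact: det_rowsub_perm.
Qed.

(** The Cauchy-Binet formula, with the sum over all maps instead of increasing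
    ones: noninjective maps contribute 0, and each k-element image is counted
    k! times.  This form follows by averaging [sum_rowsub_det] over the
    permutations of the summation index, which turns the product of entries
    of [A] into a determinant. *)
Lemma symmetrized_Cauchy_Binet (R : comNzRingType) (k m : nat)
    (A : 'M[R]_(k, m)) (B : 'M[R]_(m, k)) :
  \det (A *m B) *+ k`! =
    \sum_(f : {ffun 'I_k -> 'I_m}) \det (colsub f A) * \det (rowsub f B).
Proof.
have reindexed (s : 'S_k) : \det (A *m B) =
    \sum_(f : {ffun 'I_k -> 'I_m})
       (-1) ^+ s * (\prod_i A i (f (s i))) * \det (rowsub f B).
  rewrite sum_rowsub_det.
  pose h (t : 'S_k) (f : {ffun 'I_k -> 'I_m}) := [ffun i => f (t i)].
  rewrite (reindex (h s)) /=; last first.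
    exists (h s^-1%g) => f _; apply/ffunP => i.
      by rewrite !ffunE permKV.
    by rewrite !ffunE permK.
  apply: eq_bigr => f _.
  have -> : rowsub (h s f) B = rowsub (f \o s) B.
    by apply/matrixP => i j; rewrite !mxE ffunE.
  rewrite det_rowsub_perm mulrA [_ * (-1) ^+ _]mulrC; congr (_ * _ * _).
  by apply: eq_bigr => i _; rewrite ffunE.
have -> : \det (A *m B) *+ k`! = \sum_(s : 'S_k) \det (A *m B).
  by rewrite sumr_const card_Sn.
under eq_bigr => s _ do rewrite (reindexed s).
rewrite exchange_big /=; apply: eq_bigr => f _.
rewrite /determinant -mulr_suml; congr (_ * _).
apply: eq_bigr => s _; congr (_ * _).
by apply: eq_bigr => i _; rewrite !mxE.
Qed.

(** Brings an arbitrary term of [symmetrized_Cauchy_Binet] back to a pair of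
    genuine minors. *)
Lemma exists_sorting_perm (k m : nat) (f : 'I_k -> 'I_m) :
  exists s : 'S_k, {homo f \o s : i j / (i <= j)%N}.
Proof.
pose leI := relpre val leq : rel 'I_m.
have /tuple_permP[s s_sorts] :
    perm_eq (sort leI [tuple f i | i < k]) [tuple f i | i < k].
  by rewrite perm_sort.
exists s => i j le_ij.
have leI_tr : transitive leI by move=> x y z; apply: leq_trans.
have leI_tot : total leI by move=> x y; apply: leq_total.
have := sort_sorted leI_tot [tuple f i | i < k].
rewrite s_sorts.
case: k f i j s {s_sorts} le_ij => [f [] //|k] f i j s le_ij.
move=> /(sorted_leq_nth leI_tr (fun x => leqnn (val x)) (f i)).
move=> /(_ i j); rewrite !inE !size_tuple !ltn_ord => /(_ isT isT le_ij).
by rewrite -!tnth_nth !tnth_mktuple.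
Qed.

(** In the symmetrized Cauchy-Binet sum, sorting the index map multiplies both
    determinants by the same sign, so every term is either 0 or a product of
    two minors with increasing indices. *)
Lemma minors_nonneg_mul (R : numDomainType) (m p q : nat)
    (A : 'M[R]_(m, p)) (B : 'M[R]_(p, q)) :
  minors_nonneg A -> minors_nonneg B -> minors_nonneg (A *m B).
Proof.
move=> A_ge0 B_ge0 k f g f_incr g_incr.
have -> : mxsub f g (A *m B) = rowsub f A *m colsub g B.
  apply/matrixP => i j; rewrite !mxE.
  by apply: eq_bigr => l _; rewrite !mxE.
rewrite -(pmulrn_lge0 _ (fact_gt0 k)) symmetrized_Cauchy_Binet.
apply: sumr_ge0 => h _.
have [s h_mono] := exists_sorting_perm h.
have -> : \det (colsub h (rowsub f A)) * \det (rowsub h (colsub g B)) =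
    \det (colsub (h \o s) (rowsub f A)) * \det (rowsub (h \o s) (colsub g B)).
  rewrite det_colsub_perm det_rowsub_perm mulrACA -expr2 sqrr_sign.
  by rewrite mul1r.
(* A noninjective index map repeats a row of the right-hand factor. *)
have [h_inj|] := boolP (injectiveb (h \o s)); last first.
  case/injectivePn => i1 [i2 ne_i12 eq_h].
  rewrite [X in _ * X](determinant_alternate ne_i12) ?mulr0 // => j.
  by rewrite !mxE eq_h.
have hs_incr : {homo h \o s : i j / (i < j)%N}.
  move=> i j lt_ij; rewrite ltn_neqAle h_mono 1?ltnW // andbT.
  apply: contraTneq lt_ij => /val_inj/(injectiveP _ h_inj) ->.
  by rewrite ltnn.
apply: mulr_ge0.
  have -> : colsub (h \o s) (rowsub f A) = mxsub f (h \o s) A.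
    by apply/matrixP => i j; rewrite !mxE.
  exact: A_ge0.
have -> : rowsub (h \o s) (colsub g B) = mxsub (h \o s) g B.
  by apply/matrixP => i j; rewrite !mxE.
exact: B_ge0.
Qed.

Lemma incr_perm1 (k : nat) (s : 'S_k) :
  {homo s : i j / (i < j)%N} -> s = 1%g.
Proof.
have incr_ge (t : 'S_k) : {homo t : i j / (i < j)%N} ->
      forall i : 'I_k, (i <= t i)%N.
  move=> t_incr [i lt_ik]; elim: i lt_ik => // i IHi lt_ik.
  apply: leq_ltn_trans (IHi (ltnW lt_ik)) _.
  exact: t_incr.
move=> s_incr.
have sV_incr : {homo s^-1%g : i j / (i < j)%N}.
  move=> i j; apply: contraTltn; rewrite leq_eqVlt -leqNgt.
  case/orP => [/eqP/val_inj/perm_inj -> //|/s_incr].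
  by rewrite !permKV => /ltnW.
apply/permP => i; apply/val_inj/eqP; rewrite perm1 eqn_leq incr_ge // andbT.
by rewrite -{2}(permK s i) incr_ge.
Qed.

Definition noncrossing (R : nmodType) (m p : nat) (A : 'M[R]_(m, p)) :=
  forall i i' j j', A i j != 0 -> A i' j' != 0 -> (i < i')%N -> (j <= j')%N.

(** Only the identity permutation can contribute to the Leibniz expansion of a
    minor: a permutation with nonzero product is increasing. *)
Lemma noncrossing_minors_nonneg (R : numDomainType) (m p : nat)
    (A : 'M[R]_(m, p)) :
  (forall i j, 0 <= A i j) -> noncrossing A -> minors_nonneg A.
Proof.
move=> A_ge0 A_nc k f g f_incr g_incr.
rewrite /determinant; apply: sumr_ge0 => s _.
have [->|s_neq1] := eqVneq s 1%g.
  by rewrite odd_perm1 mul1r; apply: prodr_ge0 => i _; rewrite mxE.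
suff /existsP[i /eqP A0] : [exists i, mxsub f g A i (s i) == 0].
  by rewrite (bigD1 i) //= A0 mul0r mulr0.
apply: contraNT s_neq1; rewrite negb_exists => /forallP A_neq0.
apply/eqP/incr_perm1 => i j lt_ij.
have := A_nc _ _ _ _ _ _ (f_incr _ _ lt_ij).
have := A_neq0 i; have := A_neq0 j; rewrite !mxE => Aj Ai /(_ _ _ Ai Aj).
apply: contraTltn; rewrite leq_eqVlt -ltnNge.
case/orP => [/eqP/val_inj/perm_inj eij|/g_incr //].
by rewrite eij ltnn in lt_ij.
Qed.

Lemma minors_nonneg1 (R : numDomainType) (m : nat) :
  minors_nonneg (1%:M : 'M[R]_m).
Proof.
apply: noncrossing_minors_nonneg => [i j|i i' j j']; first by rewrite mxE ler0n.
rewrite !mxE !pnatr_eq0 !eqb0 !negbK => /eqP <- /eqP <-; exact: ltnW.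
Qed.

Lemma minors_nonneg_castmx (R : numDomainType) (m p q : nat) (e : p = q)
    (A : 'M[R]_(m, p)) :
  minors_nonneg A -> minors_nonneg (castmx (erefl, e) A).
Proof. by case: q / e; rewrite castmx_id. Qed.

End Minors.

(** * The edges and layers of the polygonal chain *)

Section Layers.

(** The number n - 2 of vertices added with each new cell. *)
Variable m : nat.
Hypothesis m_gt0 : 0 < m.

(** For positive [q] this is the last vertex of the q-th cell.  The vertices
    from 3 on split into the intervals from [(corner q).+1] to
    [corner q.+1]. *)
Definition corner (q : nat) : nat := q * m + 2.

(** The edges of the infinite chain containing all the Gamma_{n,r}: whether two
    edges cross does not depend on r.  [OpenSecond] is not an instance of
    [Open] because the second cell starts at 1 rather than at [corner 0],
    which is 2. *)
Inductive chain_edge : nat -> nat -> Prop :=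
| Step u of 0 < u & (forall q, u != corner q.+1) : chain_edge u u.+1
| CloseFirst : chain_edge (corner 1) 1
| OpenSecond : chain_edge 1 (corner 1).+1
| Open q : chain_edge (corner q.+1) (corner q.+2).+1
| Close q : chain_edge (corner q.+2) (corner q.+1).

Lemma neq_corner (q u : nat) :
  corner q < u < corner q.+1 -> forall q', u != corner q'.+1.
Proof.
move=> /andP[lt_qu lt_uq] q'; apply/eqP => eq_u.
have lt_qq' : q * m < q'.+1 * m by rewrite /corner in lt_qu eq_u; lia.
have lt_q'q : q'.+1 * m < q.+1 * m by rewrite /corner in lt_uq eq_u; lia.
move: lt_qq' lt_q'q; rewrite !ltn_pmul2r //; lia.
Qed.

Lemma path_edges_chain (q a b u v : nat) :
  corner q < a -> b < corner q.+1 ->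
  (u, v) \in path_edges a b -> chain_edge u v.
Proof.
move=> lt_qa lt_bq /mapP[j]; rewrite mem_index_iota => j_ab [-> ->].
by apply: Step; [lia | apply: (@neq_corner q); lia].
Qed.

Lemma edges_chain (r u v : nat) :
  (u, v) \in edges m.+2 r -> chain_edge u v.
Proof.
rewrite /edges mem_cat => /orP[|]; last rewrite mem_cat => /orP[].
- rewrite /first_edges mem_cat mem_seq1 => /orP[/mapP[j]|/eqP[-> ->]].
    rewrite mem_index_iota => j_ab [-> ->]; apply: Step; first by lia.
    by move=> q; rewrite /corner mulSn; apply/eqP; lia.
  have -> : m.+2 = corner 1 by rewrite /corner; lia.
  exact: CloseFirst.
- case: ifP => // _; rewrite /second_edges in_cons mem_cat mem_seq1.
  case/or3P => [/eqP[-> ->]||/eqP[-> ->]].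
  + have -> : m.+2 + 1 = (corner 1).+1 by rewrite /corner; lia.
    exact: OpenSecond.
  + by apply: (@path_edges_chain 1); rewrite /corner; lia.
  + have -> : 2 * m.+2 - 2 = corner 2 by rewrite /corner; lia.
    have -> : m.+2 = corner 1 by rewrite /corner; lia.
    exact: Close.
case/flattenP => _ /mapP[i i_r ->]; move: i_r; rewrite mem_iota.
case: i => [|i] // _.
rewrite /F in_cons mem_cat mem_seq1; case/or3P => [/eqP[-> ->]||/eqP[-> ->]].
- set u' := (X in chain_edge X); set v' := (X in chain_edge _ X).
  have -> : u' = corner i.+1 by rewrite /u' /corner; lia.
  have -> : v' = (corner i.+2).+1 by rewrite /v' /corner; lia.
  exact: Open.
- by apply: (@path_edges_chain i.+2); rewrite /corner; lia.
- set u' := (X in chain_edge X); set v' := (X in chain_edge _ X).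
  have -> : u' = corner i.+3 by rewrite /u' /corner; lia.
  have -> : v' = corner i.+2 by rewrite /v' /corner; lia.
  exact: Close.
Qed.

(** A lift of the layer to the integers, shifted by 1.  From one vertex to the
    next it grows by 1 inside a cell and by 2 on entering a new cell: if [w] is
    the last vertex of a cell, the first new vertex of the next cell is the
    successor not of [w] but of the head of the closing edge leaving [w].  For
    [v < 3] the truncated subtraction gives [height v = v]. *)
Definition height (v : nat) : nat := v + (v - 3) %/ m.

Lemma height_in_cell (q v : nat) :
  corner q < v <= corner q.+1 -> height v = v + q.
Proof.
rewrite /corner /height => v_q; congr (_ + _).
have -> : v - 3 = q * m + (v - 3 - q * m) by lia.
by rewrite divnMDl // divn_small ?addn0 //; lia.
Qed.

Lemma height_corner (q : nat) : height (corner q.+1) = corner q.+1 + q.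
Proof. by apply: height_in_cell; rewrite /corner mulSn; lia. Qed.

Lemma height_small (v : nat) : v <= corner 1 -> height v = v.
Proof.
by rewrite /corner /height => v_q; rewrite divn_small ?addn0; lia.
Qed.

Lemma height_step (u : nat) :
  0 < u -> (forall q, u != corner q.+1) -> height u.+1 = (height u).+1.
Proof.
move=> u_gt0 u_ncorner; have [u_le|lt_u] := leqP u.+1 (corner 1).
  by rewrite !height_small //; lia.
have [q u_q] : exists q, corner q < u < corner q.+1.
  exists ((u - 3) %/ m); have := u_ncorner ((u - 3) %/ m).
  have := divn_eq (u - 3) m; have := ltn_pmod (u - 3) m_gt0.
  by move: lt_u; rewrite /corner !mulSn; lia.
by rewrite !(@height_in_cell q); lia.
Qed.

Lemma chain_edge_height (u v : nat) :
  chain_edge u v -> height v = (height u).+1 %[mod m.+2].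
Proof.
case=> [w w_gt0 w_nc|||q|q].
- by rewrite height_step.
- rewrite !height_small // /corner ?mul1n ?addn2 ?modnn; last by lia.
  by rewrite -[m.+3]addn1 modnDl.
- rewrite (@height_in_cell 1) ?(@height_small 1); try by rewrite /corner; lia.
  have -> : (corner 1).+1 + 1 = m.+2 + 2 by rewrite /corner; lia.
  by rewrite modnDl.
- rewrite (@height_in_cell q.+2) ?height_corner; last by rewrite /corner; lia.
  have -> : (corner q.+2).+1 + q.+2 = m.+2 + (corner q.+1 + q).+1.
    by rewrite /corner; lia.
  by rewrite modnDl.
- rewrite !height_corner.
  have -> : (corner q.+2 + q.+1).+1 = m.+2 + (corner q.+1 + q).
    by rewrite /corner; lia.
  by rewrite modnDl.
Qed.

(** Any function that grows by 1 modulo n along every edge describes the layers,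
    whatever the order in which the edges are added: each new value is read
    off the tail of an edge, where the invariant already holds. *)
Lemma foldl_add_edge_potential (n : nat) (phi : nat -> nat)
    (s : seq (nat * nat)) (l : nat -> option nat) :
  (forall u v, (u, v) \in s -> phi v = (phi u).+1 %[mod n]) ->
  (forall v c, l v = Some c -> c.+1 = phi v %[mod n]) ->
  forall v c, foldl (add_edge n) l s v = Some c -> c.+1 = phi v %[mod n].
Proof.
elim: s l => [|[u w] s IHs] l //= s_phi l_phi; apply: IHs => [x y xy_s|].
  by apply: s_phi; rewrite inE xy_s orbT.
move=> v c; rewrite /add_edge /=; case lw: (l w) => [d|]; first exact: l_phi.
rewrite /=; case: eqVneq => [->|_]; last exact: l_phi.
case lu: (l u) => [d|] //= [<-].
rewrite (s_phi u w) ?mem_head // -[(d.+1 %% n).+1]addn1.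
by rewrite (l_phi _ _ lu) modnDml addn1.
Qed.

Lemma layer_height (r v c : nat) :
  layer m.+2 r v = Some c -> c.+1 = height v %[mod m.+2].
Proof.
rewrite /layer; move: v c.
apply: (@foldl_add_edge_potential m.+2 height) => [u w /edges_chain|w d].
  exact: chain_edge_height.
by rewrite /=; case: eqVneq => // -> [<-]; rewrite height_small // /corner; lia.
Qed.

(** The two alternatives are needed: the heights of [corner q.+1] and
    [corner q.+3] differ by 2 m + 2, which exceeds m + 2 but lies strictly
    between the first two positive multiples of m + 2. *)
Lemma eq_modn_gap (n x y : nat) :
  x = y %[mod n] -> x < y -> x + n = y \/ x + 2 * n <= y.
Proof.
move=> /esym/eqP eq_xy lt_xy; rewrite eqn_mod_dvd 1?ltnW // in eq_xy.
have /dvdnP[[|[|k]] def_yx] := eq_xy; [lia | lia | right].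
have := leq_addr (k * n) (2 * n); rewrite -mulnDl => le_2n.
have -> : y = x + (2 + k) * n by rewrite -def_yx; lia.
by rewrite leq_add2l.
Qed.

Lemma leq_corner (p q : nat) : (corner p <= corner q) = (p <= q).
Proof. by rewrite leq_add2r leq_pmul2r. Qed.

Lemma ltn_corner (p q : nat) : (corner p < corner q) = (p < q).
Proof. by rewrite ltn_add2r ltn_pmul2r. Qed.

Lemma leq_height (u v : nat) : u <= v -> height u <= height v.
Proof. by move=> le_uv; rewrite leq_add // leq_div2r // leq_sub2r. Qed.

Lemma ltn_height (u v : nat) : u < v -> height u < height v.
Proof.
move=> lt_uv.
by rewrite -addSn leq_add // leq_div2r // leq_sub2r // ltnW.
Qed.

(** Steps preserve the order, so a crossing must involve an edge that opens or
    closes a cell.  In each such configuration the heights of the two tails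
    differ by less than m + 2, or by exactly 2 m + 2, and so are not
    congruent. *)
Lemma chain_edge_noncrossing (u v u' v' : nat) :
  chain_edge u v -> chain_edge u' v' -> height u = height u' %[mod m.+2] ->
  u < u' -> v <= v'.
Proof.
move=> uv uv' eq_h lt_uu'.
have height1 : height 1 = 1 by rewrite height_small // /corner; lia.
have c1 : corner 1 = m.+2 by rewrite /corner; lia.
have cS q : corner q.+1 = corner q + m by rewrite /corner; lia.
have gap := eq_modn_gap eq_h (ltn_height lt_uu').
case: uv lt_uu' gap {eq_h} => [w w_gt0 w_nc|||q|q];
  case: uv' => [w' w'_gt0 w'_nc|||q'|q'] lt_uu' gap //;
  rewrite ?height1 ?height_corner ?ltn_corner ?c1 in lt_uu' gap *; try lia.
(* The pairs left are, in order, [Step] before [CloseFirst], [Open] and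
   [Close]; [CloseFirst] before [Close]; and each of [OpenSecond], [Open] and
   [Close] before [Step], [Open] and [Close]. *)
- by have := leq_addr ((w - 3) %/ m) w; rewrite -/(height w); lia.
- by have := cS q'.+1; lia.
- rewrite ltnNge; apply/negP => /leq_height; rewrite height_corner.
  by have := cS q'.+1; lia.
- by rewrite /corner; lia.
- rewrite ltnS leqNgt; apply/negP => lt_w'.
  by rewrite (@height_small w') ?c1 in gap; lia.
- by have := leq_corner 1 q'.+2; rewrite c1; lia.
- by case: q' {lt_uu'} gap => // gap; have := cS 1; lia.
- rewrite ltnS leqNgt; apply/negP => /ltn_height; rewrite height_corner.
  by have := cS q.+1; lia.
- by rewrite ltnS leq_corner; lia.
- rewrite ltnNge; apply/negP => le_q'q.
  have [eq_q'|eq_q'] : q' = q \/ q' = q.+1 by lia.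
    by rewrite eq_q' in gap; have := cS q.+1; lia.
  by rewrite eq_q' in gap; have := cS q.+1; have := cS q.+2; lia.
- by have := cS q.+1; lia.
- by apply: leqW; rewrite leq_corner; lia.
- by rewrite leq_corner; lia.
Qed.

End Layers.

(** * The factors and their product *)

Lemma B_noncrossing (n r c : nat) : 3 <= n -> noncrossing (B n r c).
Proof.
case: n => [|[|m]] //; rewrite !ltnS => m_gt0 i i' j j'.
rewrite !mxE !pnatr_eq0 !eqb0 !negbK.
move=> /(edges_chain m_gt0) uv /(edges_chain m_gt0) uv' lt_ii'.
have sortedV d : sorted ltn (V m.+2 r d).
  by apply: sorted_filter (iota_ltn_sorted _ _); apply: ltn_trans.
have nthV_mono d : {in gtn (size (V m.+2 r d)) &,
    {homo nth 0 (V m.+2 r d) : p q / p < q}}.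
  exact: sorted_ltn_nth ltn_trans 0 _ (sortedV d).
have layerV (p : 'I_(size (V m.+2 r c))) :
    layer m.+2 r (nth 0 (V m.+2 r c) p) = Some (c %% m.+2).
  by have := mem_nth 0 (ltn_ord p); rewrite mem_filter => /andP[/eqP].
rewrite leqNgt; apply/negP => /(nthV_mono _ j' j (ltn_ord _) (ltn_ord _)).
rewrite ltnNge => /negP[].
apply: (chain_edge_noncrossing m_gt0 uv uv').
  by rewrite -!(layer_height m_gt0 (layerV _)).
exact: (nthV_mono c i i' (ltn_ord _) (ltn_ord _) lt_ii').
Qed.

Lemma B_prod_minors_nonneg (n r k : nat) :
  3 <= n -> minors_nonneg (B_prod n r k).
Proof.
move=> n_ge3; elim: k => [|k IHk]; first exact: minors_nonneg1.
apply: minors_nonneg_mul IHk _; apply: noncrossing_minors_nonneg.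
  by move=> i j; rewrite mxE ler0n.
exact: B_noncrossing.
Qed.

Theorem proposition3p1 (n r : nat) (hn : 3 <= n) (hr : 1 <= r) :
  totally_nonnegative (K n r).
Proof. exact/minors_nonneg_castmx/B_prod_minors_nonneg. Qed.
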